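(* Let $n$ be a positive integer with decimal expansion $d_1 d_2 \ldots d_k$ (so $d_1 \neq 0$), and let $M_1(n)$ denote the largest number that can be obtained from $n$ by one Choix de Bruxelles operation. If every digit satisfies $d_i < 5$, then $M_1(n) = 2n$. Otherwise, let $p$ be the largest index with $d_p \ge 5$; then $M_1(n)$ is the number obtained by doubling the substring $d_p d_{p+1}\ldots d_k$, i.e. $M_1(n)$ is the number whose decimal expansion is $d_1 \ldots d_{p-1}$ followed by the decimal expansion of $2\cdot(d_p d_{p+1}\ldots d_k)$.
   Context: The Choix de Bruxelles operation: given a positive integer $n$ with decimal expansion $d_1 d_2 \ldots d_k$, choose indices $1 \le p \le q \le k$ with $d_p \neq 0$, let $s$ be the number with decimal representation $d_p d_{p+1}\ldots d_q$, and replace this substring in situ by the decimal expansion of $2s$, or, if $s$ is even, by the decimal expansion of $s/2$. One may also leave $n$ unchanged (empty substring). For example, $16$ can become any of $16, 26, 13, 112, 8, 32$. *)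

(* Defs.v *)
From mathcomp Require Import all_boot.

Set Implicit Arguments.
Unset Strict Implicit.
Unset Printing Implicit Defensive.

(* Digit strings are sequences of naturals, most significant digit first;
   positions in them are numbered from 1. *)

Definition undigits (d : seq nat) : nat := foldl (fun a x => 10 * a + x) 0 d.

(* A positive n has (trunc_log 10 n).+1 decimal digits; digits 0 = [:: 0]. *)
Definition digits (n : nat) : seq nat :=
  [seq n %/ 10 ^ i %% 10 | i <- rev (iota 0 (trunc_log 10 n).+1)].

Definition digit (d : seq nat) (i : nat) : nat := nth 0 d i.-1.

(* The substring d_p ... d_q. *)
Definition substring (d : seq nat) (p q : nat) : seq nat := drop p.-1 (take q d).

(* The number obtained from d when the substring d_p ... d_q is replaced in
   situ by the decimal expansion of t. *)
Definition replace (d : seq nat) (p q t : nat) : nat :=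
  undigits (take p.-1 d ++ digits t ++ drop q d).

Definition moves (d : seq nat) (p q : nat) : seq nat :=
  if digit d p == 0 then [::] else
  let s := undigits (substring d p q) in
  replace d p q (2 * s) :: (if odd s then [::] else [:: replace d p q s./2]).

Definition choix (n : nat) : seq nat :=
  let d := digits n in
  let k := size d in
  n :: flatten [seq moves d p q | p <- iota 1 k, q <- iota p (k.+1 - p)].

Definition M1 (n : nat) : nat := \max_(m <- choix n) m.

Lemma undigits_rcons d x : undigits (rcons d x) = 10 * undigits d + x.
Proof. by rewrite /undigits -cats1 foldl_cat. Qed.

Lemma digits_lt10 n : all (fun x => x < 10) (digits n).
Proof. by apply/allP => _ /mapP[i _ ->]; rewrite ltn_mod. Qed.

Lemma digitsK n : undigits (digits n) = n.
Proof.
suff H k m : m < 10 ^ k ->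
    undigits [seq m %/ 10 ^ i %% 10 | i <- rev (iota 0 k)] = m.
  exact/H/trunc_log_ltn.
elim: k m => [|k IH] m; first by rewrite expn0 ltnS leqn0 => /eqP ->.
move=> mlt; rewrite -[iota 0 k.+1]/(0 :: iota (1 + 0) k) iotaDl rev_cons.
rewrite map_rcons undigits_rcons -map_rev -map_comp expn0 divn1.
rewrite [map _ _](_ : _ = [seq m %/ 10 %/ 10 ^ i %% 10 | i <- rev (iota 0 k)]).
  by rewrite IH ?ltn_divLR -?expnSr // mulnC -divn_eq.
by apply: eq_map => i /=; rewrite add1n expnS divnMA.
Qed.

Lemma digit1_digits n : 0 < n -> digit (digits n) 1 != 0.
Proof.
move=> n0; rewrite /digit /digits -[X in iota 0 X]addn1 iotaD rev_cat /= add0n.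
have /andP[lo hi] := trunc_log_bounds (isT : 1 < 10) n0.
rewrite modn_small ?ltn_divLR ?expn_gt0 -?expnS //.
by rewrite -lt0n divn_gt0 ?expn_gt0.
Qed.

Lemma choixP n m (d := digits n) : reflect
  (m = n \/ exists p q, [/\ 1 <= p <= q, q <= size d, digit d p <> 0 &
     let s := undigits (substring d p q) in
     m = replace d p q (2 * s) \/ ~~ odd s /\ m = replace d p q s./2])
  (m \in choix n).
Proof.
rewrite inE; apply: (iffP orP) => -[/eqP|]; [by left| |by left|].
  case/flattenP => _ /allpairsPdep[p [q [pI qI ->]]].
  rewrite /moves; case: eqP => // dp; move: pI qI; rewrite !mem_iota.
  move=> /andP[p1 pk] /andP[pq]; rewrite (subnKC (ltnW pk)) ltnS => qk.
  rewrite inE => H; right; exists p, q; split=> //; first by rewrite p1.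
  case/orP: H => [/eqP|]; first by left.
  by case: ifP => // e; rewrite inE => /eqP ->; right.
case=> p [q [/andP[p1 pq] qk dp H]]; right; apply/flattenP.
have pk := leq_trans pq qk.
exists (moves d p q).
  apply/allpairsPdep; exists p, q; rewrite !mem_iota p1 pq.
  by rewrite add1n ltnS pk (subnKC (leqW pk)) ltnS.
rewrite /moves; case: eqP => // _; rewrite inE.
case: H => [->|[/negPf-> ->]]; first by rewrite eqxx.
by rewrite inE eqxx orbT.
Qed.

(* Main.v *)
Require Import Defs.
From mathcomp Require Import all_boot zify.

(** Every move turns [a ++ s ++ b] into [a ++ t ++ b] with [t] the expansion of
    a number at most twice [s], and [t] is longer than [s], by one digit, only
    when [s] starts with a digit at least 5; the new first digit is then 1.  If
    no digit is at least 5, no move lengthens the number, so none adds more than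
    the number itself.  Otherwise doubling [d_p ... d_k] lengthens the number and
    beats all moves that do not; a lengthening move that starts before [p] writes
    a 1 where this one keeps a digit at least 5. *)

Lemma undigits_cat u v :
  undigits (u ++ v) = undigits u * 10 ^ size v + undigits v.
Proof.
elim/last_ind: v => [|v x IH]; first by rewrite cats0 muln1 addn0.
by rewrite -rcons_cat !undigits_rcons IH size_rcons expnS; lia.
Qed.

Lemma undigits_cons x u : undigits (x :: u) = x * 10 ^ size u + undigits u.
Proof. by rewrite -cat1s undigits_cat. Qed.

Lemma undigits_lt u : all (fun x => x < 10) u -> undigits u < 10 ^ size u.
Proof.
elim: u => //= x u IH /andP[xlt /IH ult].
by rewrite undigits_cons expnS; nia.
Qed.

Lemma undigits_head_ge h x u : h <= x -> h * 10 ^ size u <= undigits (x :: u).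
Proof. by move=> hx; rewrite undigits_cons; nia. Qed.

Lemma undigits_head_lt h x u :
  all (fun x => x < 10) u -> x < h -> undigits (x :: u) < h * 10 ^ size u.
Proof. by move=> /undigits_lt ult xh; rewrite undigits_cons; nia. Qed.

Lemma undigits_inj u v : size u = size v ->
  all (fun x => x < 10) u -> all (fun x => x < 10) v ->
  undigits u = undigits v -> u = v.
Proof.
elim: u v => [|x u IH] [|y v] //= [suv] /andP[_ uT] /andP[_ vT].
rewrite !undigits_cons suv => E.
have ult := undigits_lt _ uT; have vlt := undigits_lt _ vT.
rewrite suv in ult.
have xy : x = y by nia.
by rewrite xy (IH v) //; nia.
Qed.

Lemma size_digits n : size (digits n) = (trunc_log 10 n).+1.
Proof. by rewrite size_map size_rev size_iota. Qed.

Lemma size_digits_leq m n : 0 < m -> n < 10 ^ m -> size (digits n) <= m.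
Proof.
move=> m0 nlt; rewrite size_digits.
case: (posnP n) => [->|n0]; first by rewrite trunc_log0.
have /andP[lo _] := trunc_log_bounds (isT : 1 < 10) n0.
by rewrite -(ltn_exp2l (m := 10)) //; apply: leq_ltn_trans nlt.
Qed.

Lemma size_digits_eq m n :
  10 ^ m <= n -> n < 10 ^ m.+1 -> size (digits n) = m.+1.
Proof.
by move=> lo hi; rewrite size_digits; congr _.+1; apply: trunc_log_eq; rewrite ?lo.
Qed.

(** The nonzero leading digit forces the canonical length, and two digit strings of equal length and
    equal value coincide. *)
Lemma undigitsK x u : x != 0 -> all (fun x => x < 10) (x :: u) ->
  digits (undigits (x :: u)) = x :: u.
Proof.
move=> x0 ulow; apply: undigits_inj; rewrite ?digitsK ?digits_lt10 //.
apply: size_digits_eq; last exact: (undigits_lt _ ulow).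
by rewrite -[X in X <= _]mul1n undigits_head_ge // lt0n.
Qed.

(** The upper bounds need only that a move at most doubles its substring, so doubling, halving and
    doing nothing share one form. Leaving [n] unchanged counts as replacing the whole expansion by
    [n]. *)
Lemma choix_bound n m : m \in choix n ->
  exists a x s b t, [/\ digits n = a ++ (x :: s) ++ b,
    t <= 2 * undigits (x :: s) & m = undigits (a ++ digits t ++ b)].
Proof.
move=> /choixP[->|[p [q [/andP[p1 pq] qk dp H]]]].
  have : size (digits n) != 0 by rewrite size_digits.
  case E: (digits n) => [|x s] // _.
  exists [::], x, s, [::], n.
  by rewrite /= !cats0 -E digitsK; split=> //; lia.
have : size (substring (digits n) p q) != 0.
  by rewrite size_drop size_takel //; lia.
case E: (substring (digits n) p q) => [|x s] // _.
have D : digits n = take p.-1 (digits n) ++ (x :: s) ++ drop q (digits n).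
  rewrite -E /substring -[LHS](cat_take_drop q) catA; congr (_ ++ _).
  by rewrite -[LHS](cat_take_drop p.-1) take_takel //; lia.
move: H; rewrite E /= /replace => H.
exists (take p.-1 (digits n)), x, s, (drop q (digits n)).
by case: H => [->|[_ ->]]; [exists (2 * undigits (x :: s)) |
  exists (undigits (x :: s))./2]; split=> //; lia.
Qed.

Lemma doubling_in_choix a x s n : digits n = a ++ x :: s -> x != 0 ->
  undigits (a ++ digits (2 * undigits (x :: s))) \in choix n.
Proof.
move=> D x0; apply/choixP; right; exists (size a).+1, (size (digits n)).
have sz : size (digits n) = size a + (size s).+1 by rewrite D size_cat.
split; [by lia | by [] | |].
  by rewrite /digit D nth_cat ltnn subnn; apply/eqP.
left; rewrite /replace /substring take_size drop_size D /=.
by rewrite drop_size_cat // take_size_cat // cats0.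
Qed.

(** A leading digit at most 4 keeps the value below [5 * 10 ^ size s], so its double stays below
    [10 ^ (size s).+1]. *)
Lemma size_digits_double_leq x s t :
  all (fun x => x < 10) s -> x < 5 -> t <= 2 * undigits (x :: s) ->
  size (digits t) <= size (x :: s).
Proof.
move=> slow x5 tle; apply: size_digits_leq => //=.
by have := undigits_head_lt _ _ _ slow x5; rewrite expnS; lia.
Qed.

Lemma size_digits_double x s : all (fun x => x < 10) (x :: s) -> 5 <= x ->
  size (digits (2 * undigits (x :: s))) = (size s).+2.
Proof.
move=> slow x5; have := undigits_lt _ slow; have := undigits_head_ge _ _ s x5.
by move=> lo hi; apply: size_digits_eq; rewrite ?expnS in hi *; lia.
Qed.

(** Without lengthening, the place value of [a] does not grow, [t] at most doubles its substring,
    and [b] stays: each contribution at most doubles. *)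
Lemma replace_bound_small a x s b t : all (fun x => x < 5) (a ++ (x :: s) ++ b) ->
  t <= 2 * undigits (x :: s) ->
  undigits (a ++ digits t ++ b) <= 2 * undigits (a ++ (x :: s) ++ b).
Proof.
rewrite /= !all_cat /= all_cat => /and4P[_ x5 s5 _] tle.
have slow : all (fun x => x < 10) s by apply: sub_all s5 => y; lia.
have sz := size_digits_double_leq _ _ _ slow x5 tle.
rewrite -cat_cons !undigits_cat digitsK !size_cat !expnD.
have : 10 ^ size (digits t) <= 10 ^ size (x :: s) by rewrite leq_exp2l.
move: (undigits (x :: s)) (10 ^ size (digits t)) (10 ^ size (x :: s)) tle.
move=> S u v tle uv.
have : undigits a * (u * 10 ^ size b) <= undigits a * (v * 10 ^ size b).
  by rewrite leq_mul2l leq_mul2r uv !orbT.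
have : t * 10 ^ size b <= 2 * S * 10 ^ size b by rewrite leq_mul2r tle orbT.
by lia.
Qed.

(** The same expansion is split twice: at its last digit [y] that is at least 5, and at the
    substring of an arbitrary move. The default [y] in [head y a0] makes this the leading digit of
    the expansion even when [a0] is empty. *)
Lemma replace_bound_carry a0 y c a x s b t :
  all (fun x => x < 10) (a0 ++ y :: c) -> head y a0 != 0 ->
  5 <= y -> all (fun x => x < 5) c ->
  a0 ++ y :: c = a ++ (x :: s) ++ b ->
  t <= 2 * undigits (x :: s) ->
  undigits (a ++ digits t ++ b) <=
  undigits (a0 ++ digits (2 * undigits (y :: c))).
Proof.
move=> low hd y5 c5 E tle.
have := low; rewrite all_cat => /andP[a0low yclow].
have := low; rewrite E /= !all_cat /= all_cat => /and4P[alow x10 slow blow].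
have size_dc := size_digits_double _ _ yclow y5.
have szE : size a0 + (size c).+1 = size a + ((size s).+1 + size b).
  by have := congr1 size E; rewrite !size_cat => ->.
(* The doubled tail gains a digit, so the claimed maximum exceeds every number as long as the
   original one. *)
have Vge : 10 ^ (size a0 + (size c).+1) <=
    undigits (a0 ++ digits (2 * undigits (y :: c))).
  case: a0 hd {low E a0low szE} => [_|z a0 /= z0].
    rewrite digitsK /= add0n expnS.
    by have := undigits_head_ge _ _ c y5; lia.
  have z1 : 1 <= z by rewrite lt0n.
  have := undigits_head_ge _ _ (a0 ++ digits (2 * undigits (y :: c))) z1.
  by rewrite mul1n size_cat size_dc addSnnS.
have short : size (digits t) <= (size s).+1 ->
    undigits (a ++ digits t ++ b) <=
    undigits (a0 ++ digits (2 * undigits (y :: c))).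
  move=> sz; apply: leq_trans Vge; apply: ltnW.
  apply: leq_trans (undigits_lt _ _) _.
    by rewrite !all_cat alow blow digits_lt10.
  by rewrite leq_exp2l // !size_cat szE; lia.
have [x5|x5] := ltnP x 5.
  exact/short/(size_digits_double_leq _ _ _ slow x5).
have [/short //|long] := leqP (size (digits t)) (size s).+1.
have sz : size (digits t) = (size s).+2.
  apply/eqP; rewrite eqn_leq long andbT; apply: size_digits_leq => //.
  have : undigits (x :: s) < 10 ^ (size s).+1 by apply: undigits_lt; rewrite /= x10.
  by rewrite !expnS; lia.
(* Only lengthening moves remain, and both results now have the same number of digits; compare where
   the two substrings start. *)
have [lt_a|gt_a|eq_a] := ltngtP (size a) (size a0).
- have Ea0 : a0 = a ++ x :: drop (size a).+1 a0.
    have e1 : a = take (size a) a0.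
      by have := congr1 (take (size a)) E; rewrite (takel_cat _ (ltnW lt_a)) take_size_cat.
    rewrite {1}e1 -[LHS](cat_take_drop (size a)); congr (_ ++ _).
    rewrite (drop_nth 0) //; congr (_ :: _).
    by have := congr1 (nth 0 ^~ (size a)) E; rewrite !nth_cat lt_a ltnn subnn.
  have szc : size (drop (size a).+1 a0 ++ digits (2 * undigits (y :: c)))
      = size s + size b + 1.
    by rewrite size_cat size_dc size_drop; lia.
  rewrite Ea0 -catA /= undigits_cat [leqRHS]undigits_cat /= szc size_cat sz.
  have := undigits_head_ge _ _
    (drop (size a).+1 a0 ++ digits (2 * undigits (y :: c))) x5.
  rewrite szc undigits_cat digitsK.
  have := undigits_lt _ blow.
  have : undigits (x :: s) < 10 ^ (size s).+1 by apply: undigits_lt; rewrite /= x10.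
  rewrite !(expnS, expnD) expn0.
  move: (undigits (x :: s)) (undigits (x :: _ ++ _)) tle => S W tle Slt blt Wge.
  (* Since [t < 2 * 10 ^ (size s).+1], the string [t] followed by [b] is worth at most
     [2 * 10 ^ (size s + size b + 1)], whereas [W] is at least 5 times that power. *)
  have : t.+1 * 10 ^ size b <= 20 * 10 ^ size s * 10 ^ size b.
    by rewrite leq_mul2r; apply/orP; right; lia.
  by lia.
(* A substring starting after [y] has its first digit in [c], against [x5]. *)
- suff : x < 5 by lia.
  have := congr1 (nth 0 ^~ (size a)) E; rewrite !nth_cat ltnn subnn.
  rewrite ltnNge (ltnW gt_a) /= -[X in nth _ _ X]prednK ?subn_gt0 //= => <-.
  by apply: (all_nthP 0 c5); lia.
have ea : a = a0.
  by have := congr1 (take (size a)) E; rewrite {1}eq_a !take_size_cat.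
have Eyc : y :: c = (x :: s) ++ b.
  by have := congr1 (drop (size a)) E; rewrite {1}eq_a !drop_size_cat.
(* With a common start, the move at most doubles [x :: s] and keeps [b], while doubling the whole
   tail doubles [b] too. *)
rewrite ea undigits_cat [leqRHS]undigits_cat size_dc size_cat sz digitsK.
have -> : (size s).+2 + size b = (size c).+2 by rewrite eq_a in szE; lia.
rewrite leq_add2l Eyc !undigits_cat digitsK.
have : t * 10 ^ size b <= 2 * undigits (x :: s) * 10 ^ size b.
  by rewrite leq_mul2r tle orbT.
by lia.
Qed.

Lemma M1_eq n m : m \in choix n ->
  (forall m', m' \in choix n -> m' <= m) -> M1 n = m.
Proof.
move=> mn ub; apply/eqP; rewrite eqn_leq /M1; apply/andP; split.
  by apply/bigmax_leqP_seq => i ? _; apply: ub.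
exact: (leq_bigmax_seq m).
Qed.

Theorem theorem1 (n : nat) (n_gt0 : 0 < n) :
  let d := digits n in
  let k := size d in
  ((forall i, 1 <= i <= k -> digit d i < 5) -> M1 n = 2 * n) /\
  (forall p, 1 <= p <= k -> 5 <= digit d p ->
     (forall i, p < i <= k -> digit d i < 5) ->
     digits (M1 n) =
       take p.-1 d ++ digits (2 * undigits (substring d p k))).
Proof.
move=> d k; have d1 := digit1_digits n_gt0; split=> [small|p pk dp small].
  have d5 : all (fun x => x < 5) d.
    by apply/(all_nthP 0) => i ik; apply: (small i.+1).
  apply: M1_eq => [|m].
    case E: (digits n) d1 => [|x s] // x0.
    by have := doubling_in_choix [::] x s _ E x0; rewrite -E /= !digitsK.
  case/choix_bound=> a [x [s [b [t [D tle ->]]]]].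
  rewrite -[n in 2 * n]digitsK D; apply: replace_bound_small => //.
  by rewrite -D.
have pk' : p.-1 < k by lia.
set a0 := take p.-1 d; set y := digit d p; set c := drop p d.
have Esub : substring d p k = y :: c.
  by rewrite /substring take_size (drop_nth 0) // prednK //; lia.
have D : d = a0 ++ y :: c by rewrite -Esub /substring take_size cat_take_drop.
have low : all (fun x => x < 10) (a0 ++ y :: c) by rewrite -D digits_lt10.
have hd : head y a0 != 0 by move: d1; rewrite -/d D /digit /=; case: (a0).
have c5 : all (fun x => x < 5) c.
  apply/(all_nthP 0) => i; rewrite size_drop nth_drop => ik.
  by apply: (small (p + i).+1); rewrite -/k in ik *; lia.
have y0 : y != 0 by rewrite -lt0n; apply: leq_trans dp.
rewrite Esub (M1_eq _ (undigits (a0 ++ digits (2 * undigits (y :: c))))); first last.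
- move=> m /choix_bound[a [x [s [b [t [D' tle ->]]]]]].
  by apply: (replace_bound_carry _ _ _ _ x s) => //; rewrite -D.
- exact: doubling_in_choix.
(* To pass from values to expansions, the concatenation must be canonical: its entries are digits
   and its leading one is nonzero. *)
have low' : all (fun x => x < 10) (a0 ++ digits (2 * undigits (y :: c))).
  by move: low; rewrite !all_cat digits_lt10 => /andP[->].
case: (a0) hd low' => [_ _|z a1 /= z0 zlow]; first by rewrite digitsK.
exact: undigitsK.
Qed.
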